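(* Let $\mathcal{C}_4=\mathbb{C}\{e_1,e_2,e_3,e_4\}$ be the complex Clifford algebra with generators satisfying $e_j^2=-1$ and $e_je_k=-e_ke_j$ ($j\ne k$), of dimension $16$, and let $\mathcal{C}_2\subset\mathcal{C}_4$ be the subalgebra with basis $1,e_1,e_2,e_{12}=e_1e_2$. Let $e_{123}=e_1e_2e_3$ (also written $e_{[3]}$), $e_{124}=e_1e_2e_4$, $e_{43}=e_4e_3$; then $e_{123}^2=e_{124}^2=1$ and $e_{43}=e_{123}e_{124}=-e_{124}e_{123}$. Every $a\in\mathcal{C}_4$ can be written as $$a=a_0+a_1e_{123}+a_2e_{124}+a_3e_{43}=a_0+e_{123}a_1+e_{124}a_2+e_{43}a_3$$ with $a_0,a_1,a_2,a_3\in\mathcal{C}_2$. Let $$P_2=\frac12\begin{pmatrix}1-ie_1 & e_2+ie_{12}\\ -e_2+ie_{12} & 1+ie_1\end{pmatrix},\qquad P_4=\frac12\begin{pmatrix}(1+e_{[3]})P_2 & (e_{124}-e_{43})P_2\\ (e_{124}+e_{43})P_2 & (1-e_{[3]})P_2\end{pmatrix}.$$ Then $P_4$ is invertible with $P_4^{-1}=P_4$, and $$P_4(aI_4)P_4^{-1}=\begin{pmatrix}\phi_2(a_0)+\phi_2(a_1) & \phi_2(a_2)+\phi_2(a_3)\\ \phi_2(a_2)-\phi_2(a_3) & \phi_2(a_0)-\phi_2(a_1)\end{pmatrix}\in\mathbb{C}^{4\times 4}.$$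
   Context: For $b=b_0+b_1e_1+b_2e_2+b_3e_{12}\in\mathcal{C}_2$ ($b_j\in\mathbb{C}$), $\phi_2(b)=\begin{pmatrix}b_0+b_1i & -(b_2+b_3i)\\ b_2-b_3i & b_0-b_1i\end{pmatrix}\in\mathbb{C}^{2\times2}$. $i$ is the imaginary unit of $\mathbb{C}$. For an element $c$ and a matrix $M$, $cM$ denotes the matrix with entries $cM_{jk}$. *)

(* Defs.v *)
(* The complex field is an arbitrary numClosedFieldType C
   (e.g. R[i] for a realType R, i.e. the complex numbers), with 'i its
   imaginary unit. *)
From HB Require Import structures.
From mathcomp Require Import all_boot all_order all_algebra.
Set Implicit Arguments. Unset Strict Implicit. Unset Printing Implicit Defensive.
Import Order.TTheory GRing.Theory Num.Theory.
Local Open Scope ring_scope.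

Notation Cl C := {ffun {set 'I_4} -> C}.

Section Clifford.
Variable C : numClosedFieldType.

(* The complex Clifford algebra C_4 = C{e_1,..,e_4}: elements are
   C-linear combinations of basis blades e_A, A a subset of {1,..,4}
   (represented by 'I_4, so generator e_(k+1) is index k). *)

(* e_A e_B = clsign A B * e_(A symdiff B), with e_A = product of e_a, a in A,
   in increasing order, e_j^2 = -1, e_j e_k = - e_k e_j. *)
Definition clsign (A B : {set 'I_4}) : C :=
  (-1) ^+ (#|[set p : 'I_4 * 'I_4 | (p.1 \in A) && (p.2 \in B) && (p.2 < p.1)%N]|
           + #|A :&: B|).

Definition symdiff (A B : {set 'I_4}) : {set 'I_4} := (A :\: B) :|: (B :\: A).

Definition clmul (x y : (Cl C)) : Cl C :=
  [ffun D => \sum_(A : {set 'I_4}) \sum_(B : {set 'I_4})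
     (if symdiff A B == D then clsign A B * x A * y B else 0)].

Definition blade (A : {set 'I_4}) : Cl C := [ffun D => if D == A then 1 else 0].

Definition cl1 : Cl C := blade set0.
Definition clC (c : C) : Cl C := [ffun D => if D == set0 then c else 0].
Definition clscal (c : C) (x : Cl C) : Cl C := [ffun D => c * x D].
Definition gen (k : 'I_4) : Cl C := blade [set k].

Definition e1 : Cl C := gen (@Ordinal 4 0 isT).
Definition e2 : Cl C := gen (@Ordinal 4 1 isT).
Definition e3 : Cl C := gen (@Ordinal 4 2 isT).
Definition e4 : Cl C := gen (@Ordinal 4 3 isT).
Definition e12 : Cl C := clmul e1 e2.
Definition e123 : Cl C := clmul (clmul e1 e2) e3.
Definition e124 : Cl C := clmul (clmul e1 e2) e4.
Definition e43 : Cl C := clmul e4 e3.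

Definition c2elt (b : 'I_4 -> C) : Cl C :=
  clC (b 0%R) + clscal (b 1%R) e1 + clscal (b 2%R) e2 + clscal (b 3%R) e12.

(* phi_2(b0 + b1 e1 + b2 e2 + b3 e12) *)
Definition phi2 (b : 'I_4 -> C) : 'M[C]_2 :=
  \matrix_(i < 2, j < 2)
    if (i == 0%R) && (j == 0%R) then b 0%R + b 1%R * 'i
    else if (i == 0%R) then - (b 2%R + b 3%R * 'i)
    else if (j == 0%R) then b 2%R - b 3%R * 'i
    else b 0%R - b 1%R * 'i.

Definition clmxmul m n p (A : 'M[Cl C]_(m, n)) (B : 'M[Cl C]_(n, p)) : 'M[Cl C]_(m, p) :=
  \matrix_(i, j) \sum_k clmul (A i k) (B k j).

Definition clscalmx n (a : (Cl C)) : 'M[Cl C]_n := \matrix_(i, j) if i == j then a else 0.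

Definition clscale m n (c : (Cl C)) (M : 'M[Cl C]_(m, n)) : 'M[Cl C]_(m, n) :=
  map_mx (clmul c) M.

Definition P2 : 'M[Cl C]_2 :=
  \matrix_(i < 2, j < 2) (clscal 2%:R^-1
    (if (i == 0%R) && (j == 0%R) then cl1 - clscal 'i e1
     else if (i == 0%R) then e2 + clscal 'i e12
     else if (j == 0%R) then - e2 + clscal 'i e12
     else cl1 + clscal 'i e1)).

Definition P4 : 'M[Cl C]_4 :=
  map_mx (clscal 2%:R^-1)
  (block_mx (clscale (cl1 + e123) P2) (clscale (e124 - e43) P2)
            (clscale (e124 + e43) P2) (clscale (cl1 - e123) P2) : 'M[Cl C]_(2 + 2)).

Definition rhs4 (a0 a1 a2 a3 : 'I_4 -> C) : 'M[C]_4 :=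
  block_mx (phi2 a0 + phi2 a1) (phi2 a2 + phi2 a3)
           (phi2 a2 - phi2 a3) (phi2 a0 - phi2 a1) : 'M[C]_(2 + 2).

End Clifford.

(* Main.v *)
(* The elements E = e123 and F = e124 commute with C_2 and satisfy E^2 = F^2 = 1 and
   FE = -EF, so C_4 is the tensor product of two quaternion algebras, one with
   x^2 = y^2 = -1 (namely C_2) and the other with x^2 = y^2 = 1. The matrix P_2 conjugates
   b I_2 into the scalar matrix phi_2(b). Each block of P_4 is a combination q of
   1, E, F, EF times P_2, and q commutes with C_2, so every block of P_4 (a I_4) P_4 is
   a combination of the phi_2(a_m) whose coefficients sum_k q_ik E_m q_kj, where E_m runs
   over 1, E, F, EF, turn out to be scalars. The case a = 1 is P_4^2 = I_4. *)
Require Import Defs.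
From HB Require Import structures.
From mathcomp Require Import all_boot all_order all_algebra.
From mathcomp Require Import ring.
Import Order.TTheory GRing.Theory Num.Theory.
Local Open Scope ring_scope.

(** * Symmetric differences of index sets and the sign in the product of two blades *)

Section Sign.
Variable C : numClosedFieldType.
Implicit Types A B D : {set 'I_4}.

Lemma in_symdiff i A B : (i \in symdiff A B) = (i \in A) (+) (i \in B).
Proof. by rewrite !inE; case: (i \in A); case: (i \in B). Qed.

Lemma symdiffA : associative symdiff.
Proof. by move=> A B D; apply/setP=> i; rewrite !in_symdiff addbA. Qed.

Lemma symdiff0s : left_id set0 symdiff.
Proof. by move=> A; apply/setP=> i; rewrite in_symdiff inE. Qed.

Lemma symdiffs0 : right_id set0 symdiff.
Proof. by move=> A; apply/setP=> i; rewrite in_symdiff inE addbF. Qed.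

Lemma symdiffss A : symdiff A A = set0.
Proof. by apply/setP=> i; rewrite in_symdiff inE addbb. Qed.

Lemma symdiffK A : involutive (symdiff A).
Proof. by move=> B; rewrite symdiffA symdiffss symdiff0s. Qed.

Lemma symdiff_eq A B D : (symdiff A B == D) = (B == symdiff A D).
Proof. by rewrite (can2_eq (symdiffK A) (symdiffK A)). Qed.

(* The squares e_j^2 = -1 are the diagonal terms i = j, so the sign is -1 to a power that is
   bilinear over F_2 in the indicators of A and B. *)
Lemma clsign_prod A B :
  clsign C A B =
  \prod_i \prod_j (-1) ^+ [&& i \in A, j \in B & (j <= i)%N].
Proof.
rewrite pair_big /= -expr_sum /clsign; congr (_ ^+ _).
rewrite -!sum1_card big_mkcond [X in (_ + X)%N]big_mkcond /=.
have -> : (\sum_(i : 'I_4) (if i \in A :&: B then 1 else 0) =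
  \sum_(p : 'I_4 * 'I_4) (if [&& p.1 \in A, p.2 \in B & p.2 == p.1] then 1 else 0))%N.
  rewrite -(pair_big xpredT xpredT (fun i j =>
    if [&& i \in A, j \in B & j == i] then 1 else 0)%N) /=.
  apply: eq_bigr => i _; rewrite (bigD1 i) //= big1 ?addn0 ?eqxx ?andbT ?inE //.
  by move=> j /negPf->; rewrite !andbF.
rewrite -big_split /=; apply: eq_bigr => -[i j] _ /=; rewrite inE /=.
rewrite [in RHS]leq_eqVlt -val_eqE.
by case: (i \in A); case: (j \in B); case: ltngtP.
Qed.

(** Membership in a symmetric difference is an exclusive or, which becomes a product of signs in
    each factor. Multiplicativity in both arguments is what makes the blade product associative. *)
Lemma clsign_symdiffl A A' B :
  clsign C (symdiff A A') B = clsign C A B * clsign C A' B.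
Proof.
rewrite !clsign_prod -big_split; apply: eq_bigr => i _ /=.
rewrite -big_split; apply: eq_bigr => j _ /=.
by rewrite in_symdiff -signr_addb -andb_addl.
Qed.

Lemma clsign_symdiffr A B B' :
  clsign C A (symdiff B B') = clsign C A B * clsign C A B'.
Proof.
rewrite !clsign_prod -big_split; apply: eq_bigr => i _ /=.
rewrite -big_split; apply: eq_bigr => j _ /=.
by rewrite in_symdiff -signr_addb -andb_addr -andb_addl.
Qed.

Lemma clsign_sqr A B : clsign C A B * clsign C A B = 1.
Proof. by rewrite /clsign -expr2 sqrr_sign. Qed.

Lemma clsign0s B : clsign C set0 B = 1.
Proof. by rewrite -[set0](symdiffss set0) clsign_symdiffl clsign_sqr. Qed.

Lemma clsigns0 A : clsign C A set0 = 1.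
Proof. by rewrite -[set0](symdiffss set0) clsign_symdiffr clsign_sqr. Qed.

Lemma clsign_set1 (i j : 'I_4) :
  clsign C [set i] [set j] = if (j <= i)%N then -1 else 1.
Proof.
rewrite clsign_prod (bigD1 i) //= (bigD1 j) //= big1 => [|k /negPf nkj].
  rewrite mulr1 big1 => [|k /negPf nki]; first by rewrite !inE !eqxx mulr1 /=; case: leq.
  by rewrite big1 // => l _; rewrite !inE nki.
by rewrite !inE nkj andbF.
Qed.

End Sign.

(** An alias that carries the Clifford product as its ring structure, apart from the pointwise
    product of finite functions. *)
Definition clifford (C : numClosedFieldType) : Type := Cl C.

(** * The algebra structure on C_4 and the relations between its generators *)

Section CliffordAlgebra.
Variable C : numClosedFieldType.
Implicit Types (x y z : Cl C) (c : C).

HB.instance Definition _ := GRing.Zmodule.on (clifford C).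

(** For given A and D, only B = A symdiff D contributes to the double sum. *)
Lemma clmulE x y D :
  clmul x y D = \sum_A clsign C A (symdiff A D) * x A * y (symdiff A D).
Proof.
rewrite ffunE; apply: eq_bigr => A _.
rewrite (bigD1 (symdiff A D)) //= symdiffK eqxx big1 ?addr0 // => B.
by rewrite symdiff_eq => /negPf->.
Qed.

Fact clmulA : associative (@clmul C).
Proof.
move=> x y z; apply/esym/ffunP=> D; rewrite !clmulE.
under eq_bigr do rewrite clmulE mulr_sumr mulr_suml.
under [RHS]eq_bigr do rewrite clmulE mulr_sumr.
rewrite exchange_big; apply: eq_bigr => B _ /=.
(* B is the index of x on both sides; shifting the inner index by B makes [symdiff B A] the index of
   y and [symdiff A D] that of z on both sides. *)
rewrite [RHS](reindex_inj (can_inj (symdiffK B))); apply: eq_bigr => A _ /=.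
have -> : symdiff (symdiff B A) (symdiff B D) = symdiff A D.
  by apply/setP=> i; rewrite !in_symdiff; do 3 case: (i \in _).
have -> : symdiff B D = symdiff (symdiff B A) (symdiff A D).
  by apply/setP=> i; rewrite !in_symdiff; do 3 case: (i \in _).
(* By bimultiplicativity the two signs differ only by the square of the sign of B and [symdiff A D],
   which is 1. *)
rewrite [clsign _ B (symdiff (symdiff B A) _)]clsign_symdiffr clsign_symdiffl.
by ring: (clsign_sqr C B (symdiff A D)).
Qed.

Fact clmul1 : left_id (cl1 C) (@clmul C).
Proof.
move=> x; apply/ffunP=> D; rewrite clmulE (bigD1 set0) //= big1 => [|A /negPf nA].
  by rewrite symdiff0s clsign0s ffunE eqxx !mul1r addr0.
by rewrite ffunE nA mulr0 mul0r.
Qed.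

Fact clmulr1 : right_id (cl1 C) (@clmul C).
Proof.
move=> x; apply/ffunP=> D; rewrite clmulE (bigD1 D) //= big1 => [|A nA].
  by rewrite symdiffss clsigns0 ffunE eqxx mulr1 mul1r addr0.
rewrite !ffunE symdiff_eq symdiffs0 [D == A]eq_sym (negPf nA) mulr0 //.
Qed.

Fact clmulDl : left_distributive (@clmul C) +%R.
Proof.
move=> x y z; apply/ffunP=> D; rewrite [RHS]ffunE !clmulE -big_split.
by apply: eq_bigr => A _ /=; rewrite ffunE mulrDr mulrDl.
Qed.

Fact clmulDr : right_distributive (@clmul C) +%R.
Proof.
move=> x y z; apply/ffunP=> D; rewrite [RHS]ffunE !clmulE -big_split.
by apply: eq_bigr => A _ /=; rewrite ffunE mulrDr.
Qed.

Fact cl1_neq0 : cl1 C != 0.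
Proof. by apply/eqP=> /ffunP/(_ set0)/eqP; rewrite !ffunE eqxx oner_eq0. Qed.

HB.instance Definition _ := GRing.Zmodule_isNzRing.Build (clifford C)
  clmulA clmul1 clmulr1 clmulDl clmulDr cl1_neq0.

Fact clscalA c d x : clscal c (clscal d x) = clscal (c * d) x.
Proof. by apply/ffunP=> D; rewrite !ffunE mulrA. Qed.

Fact clscal1 : left_id 1 (@clscal C).
Proof. by move=> x; apply/ffunP=> D; rewrite ffunE mul1r. Qed.

Fact clscalDr : right_distributive (@clscal C) +%R.
Proof. by move=> c x y; apply/ffunP=> D; rewrite !ffunE mulrDr. Qed.

Fact clscalDl x : {morph (@clscal C)^~ x : c d / c + d}.
Proof. by move=> c d; apply/ffunP=> D; rewrite !ffunE mulrDl. Qed.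

HB.instance Definition _ := GRing.Zmodule_isLmodule.Build C (clifford C)
  clscalA clscal1 clscalDr clscalDl.

Fact clscalAl c x y : clscal c (clmul x y) = clmul (clscal c x) y.
Proof.
apply/ffunP=> D; rewrite [LHS]ffunE !clmulE mulr_sumr.
by apply: eq_bigr => A _; rewrite ffunE; ring.
Qed.

Fact clscalAr c x y : clscal c (clmul x y) = clmul x (clscal c y).
Proof.
apply/ffunP=> D; rewrite [LHS]ffunE !clmulE mulr_sumr.
by apply: eq_bigr => A _; rewrite ffunE; ring.
Qed.

HB.instance Definition _ :=
  GRing.Lmodule_isLalgebra.Build C (clifford C) clscalAl.
HB.instance Definition _ :=
  GRing.Lalgebra_isAlgebra.Build C (clifford C) clscalAr.

Lemma clCE c : clC c = c *: (1 : clifford C).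
Proof. by apply/ffunP=> D; rewrite !ffunE; case: eqP => _; rewrite ?mulr1 ?mulr0. Qed.

(* The casts to clifford matter: the finite functions also carry a pointwise product. *)
Lemma blade_mul A B :
  (blade C A : clifford C) * (blade C B : clifford C) =
  clsign C A B *: (blade C (symdiff A B) : clifford C).
Proof.
apply/ffunP=> D.
change (clmul (blade C A) (blade C B) D =
        clscal (clsign C A B) (blade C (symdiff A B)) D).
rewrite clmulE ffunE (bigD1 A) //= big1 => [|A' /negPf nA'].
  rewrite !ffunE eqxx mulr1 addr0 symdiff_eq.
  by case: eqP => [->|_]; rewrite ?symdiffK ?mulr0.
by rewrite ffunE nA' mulr0 mul0r.
Qed.

Lemma gen_sqr (i : 'I_4) : (gen C i : clifford C) * (gen C i : clifford C) = -1.
Proof. by rewrite blade_mul clsign_set1 leqnn symdiffss scaleN1r. Qed.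

(** Both products are multiples of the same blade, and exactly one of the two orders is an
    inversion, so the signs are opposite. *)
Lemma gen_anticomm (i j : 'I_4) : i != j ->
  (gen C i : clifford C) * (gen C j : clifford C) =
  - ((gen C j : clifford C) * (gen C i : clifford C)).
Proof.
move=> nij; rewrite !blade_mul !clsign_set1.
have -> : symdiff [set j] [set i] = symdiff [set i] [set j].
  by apply/setP=> k; rewrite !in_symdiff addbC.
by case: ltngtP nij => [_ _|_ _|/val_inj->]; rewrite ?eqxx // scaleN1r scale1r ?opprK.
Qed.

End CliffordAlgebra.

(** * Computation in a quaternion algebra with x^2 = s, y^2 = t and yx = -xy *)

Section QuaternionAlgebra.
Variables (K : fieldType) (A : algType K) (x y : A) (s t : K).

Definition qelt (b0 b1 b2 b3 : K) : A :=
  b0%:A + b1 *: x + b2 *: y + b3 *: (x * y).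

Lemma qeltD a0 a1 a2 a3 b0 b1 b2 b3 :
  qelt a0 a1 a2 a3 + qelt b0 b1 b2 b3 =
  qelt (a0 + b0) (a1 + b1) (a2 + b2) (a3 + b3).
Proof. by rewrite /qelt !scalerDl; do 3 (rewrite addrACA; congr (_ + _)). Qed.

Lemma qeltZ c b0 b1 b2 b3 :
  c *: qelt b0 b1 b2 b3 = qelt (c * b0) (c * b1) (c * b2) (c * b3).
Proof. by rewrite /qelt !scalerDr !scalerA. Qed.

Lemma qelt_scalar c : qelt c 0 0 0 = c%:A.
Proof. by rewrite /qelt !scale0r !addr0. Qed.

(** The centralizer of z is a subalgebra. *)
Lemma qelt_comm z b0 b1 b2 b3 : GRing.comm z x -> GRing.comm z y ->
  GRing.comm z (qelt b0 b1 b2 b3).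
Proof.
have commZ c u : GRing.comm z u -> GRing.comm z (c *: u).
  by rewrite /GRing.comm -scalerAr -scalerAl => ->.
move=> zx zy; rewrite /qelt.
apply: commrD; last by apply/commZ/commrM.
by do 2 (apply: commrD; last exact: commZ); apply/commZ/commr1.
Qed.

Hypothesis xx : x * x = s%:A.
Hypothesis yy : y * y = t%:A.
Hypothesis yx : y * x = - (x * y).

Lemma mul_x_qelt b0 b1 b2 b3 :
  x * qelt b0 b1 b2 b3 = qelt (s * b1) b0 (s * b3) b2.
Proof.
rewrite /qelt !mulrDr -!scalerAr mulrA xx mulr1 -scalerAl mul1r !scalerA.
rewrite [b1 * s]mulrC [b3 * s]mulrC [b0 *: x + _]addrC; exact: addrAC.
Qed.

Lemma mul_y_qelt b0 b1 b2 b3 :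
  y * qelt b0 b1 b2 b3 = qelt (t * b2) (- t * b3) b0 (- b1).
Proof.
rewrite /qelt !mulrDr -!scalerAr mulrA yy yx mulNr -mulrA yy mulr1 -scalerAr mulr1.
rewrite !scalerN !scalerA !mulNr !scaleNr [b2 * t]mulrC [b3 * t]mulrC.
by rewrite -addrA addrC !addrA.
Qed.

Lemma qeltM a0 a1 a2 a3 b0 b1 b2 b3 :
  qelt a0 a1 a2 a3 * qelt b0 b1 b2 b3 =
  qelt (a0 * b0 + s * a1 * b1 + t * a2 * b2 - s * t * a3 * b3)
       (a0 * b1 + a1 * b0 - t * a2 * b3 + t * a3 * b2)
       (a0 * b2 + s * a1 * b3 + a2 * b0 - s * a3 * b1)
       (a0 * b3 + a1 * b2 - a2 * b1 + a3 * b0).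
Proof.
(* Only the left factor is expanded: its terms act through left multiplication by x and y, with xy
   acting as y followed by x. *)
rewrite [qelt a0 _ _ _]/qelt !mulrDl -!scalerAl mul1r -(mulrA x y).
rewrite !(mul_x_qelt, mul_y_qelt) !qeltZ !qeltD.
congr qelt; ring.
Qed.

End QuaternionAlgebra.

(** * Two commuting quaternion algebras, and the elements that their products span *)

Section TensorDecomposition.
Variables (C : numClosedFieldType) (A : algType C) (x y e f : A).
Implicit Types (b : 'I_4 -> C) (u v : A).

Hypothesis xx : x * x = (-1)%:A.
Hypothesis yy : y * y = (-1)%:A.
Hypothesis yx : y * x = - (x * y).
Hypothesis ee : e * e = 1%:A.
Hypothesis ff : f * f = 1%:A.
Hypothesis fe : f * e = - (e * f).
Hypothesis ex : GRing.comm e x.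
Hypothesis ey : GRing.comm e y.
Hypothesis fx : GRing.comm f x.
Hypothesis fy : GRing.comm f y.

Local Notation qxy := (qelt C A x y).
Local Notation qef := (qelt C A e f).
Local Notation qxyM := (qeltM C A _ _ _ _ xx yy yx).
Local Notation qefM := (qeltM C A _ _ _ _ ee ff fe).

(* The key keeps distributivity from rewriting inside quat. *)
Fact quat_key : unit. Proof. by []. Qed.
Definition quat b : A :=
  locked_with quat_key (qxy (b 0) (b 1) (b 2%:R) (b 3%:R)).

Lemma quatE b : quat b = qxy (b 0) (b 1) (b 2%:R) (b 3%:R).
Proof. by rewrite /quat unlock. Qed.

Lemma qef_comm_qxy c0 c1 c2 c3 d0 d1 d2 d3 :
  GRing.comm (qef c0 c1 c2 c3) (qxy d0 d1 d2 d3).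
Proof. by do 2 (apply: qelt_comm; apply: commr_sym). Qed.

Definition of_seq (s : seq C) (i : 'I_4) : C := nth 0 s i.

Lemma qxy_quat c0 c1 c2 c3 : qxy c0 c1 c2 c3 = quat (of_seq [:: c0; c1; c2; c3]).
Proof. by rewrite quatE. Qed.

(** The spanning argument needs closure only, so the coefficients are left to unification. *)
Lemma quatM b b' : exists b'', quat b * quat b' = quat b''.
Proof. by rewrite !quatE qxyM qxy_quat; eexists. Qed.

Lemma quatD b b' : quat b + quat b' = quat (fun i => b i + b' i).
Proof. by rewrite !quatE qeltD. Qed.

Lemma quatN b : - quat b = quat (fun i => - b i).
Proof. by rewrite !quatE -scaleN1r qeltZ !mulN1r. Qed.

Lemma quat0 : quat (fun=> 0) = 0.
Proof. by rewrite quatE qelt_scalar scale0r. Qed.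

Definition decomp (a0 a1 a2 a3 : 'I_4 -> C) : A :=
  quat a0 + quat a1 * e + quat a2 * f + quat a3 * (e * f).

(** Closure under sums and under left multiplication by generators will show that all of C_4
    satisfies this. *)
Definition decomposable u := exists a0 a1 a2 a3, u = decomp a0 a1 a2 a3.

Lemma e_quat b : e * quat b = quat b * e.
Proof. by rewrite quatE; exact: qelt_comm. Qed.

Lemma f_quat b : f * quat b = quat b * f.
Proof. by rewrite quatE; exact: qelt_comm. Qed.

Lemma decompC a0 a1 a2 a3 :
  decomp a0 a1 a2 a3 = quat a0 + e * quat a1 + f * quat a2 + (e * f) * quat a3.
Proof. by rewrite !e_quat f_quat -(mulrA e) f_quat (mulrA e) e_quat /decomp mulrA. Qed.

Lemma decomposableD u v :
  decomposable u -> decomposable v -> decomposable (u + v).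
Proof.
move=> [a0 [a1 [a2 [a3 ->]]]] [b0 [b1 [b2 [b3 ->]]]].
exists (fun i => a0 i + b0 i), (fun i => a1 i + b1 i),
  (fun i => a2 i + b2 i), (fun i => a3 i + b3 i).
rewrite /decomp -!quatD !mulrDl.
by do 3 (rewrite addrACA; congr (_ + _)).
Qed.

Lemma decomposableMl b u : decomposable u -> decomposable (quat b * u).
Proof.
move=> [a0 [a1 [a2 [a3 ->]]]].
have [b0 e0] := quatM b a0; have [b1 e1] := quatM b a1.
have [b2 e2] := quatM b a2; have [b3 e3] := quatM b a3.
by exists b0, b1, b2, b3; rewrite /decomp -e0 -e1 -e2 -e3 !mulrDr !mulrA.
Qed.

(** Since e^2 = 1 and e commutes with the coefficients, left multiplication by e exchanges 1 with e
    and f with ef. *)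
Lemma decomposable_el u : decomposable u -> decomposable (e * u).
Proof.
move=> [a0 [a1 [a2 [a3 ->]]]]; exists a1, a0, a3, a2.
rewrite /decomp !mulrDr !(mulrA e) !e_quat -!mulrA (mulrA e e) ee scale1r mul1r mulr1.
by rewrite [quat a0 * e + _]addrC addrAC.
Qed.

(** Left multiplication by f exchanges 1 with f and, because fe = -ef, exchanges e with -ef. *)
Lemma decomposable_fl u : decomposable u -> decomposable (f * u).
Proof.
move=> [a0 [a1 [a2 [a3 ->]]]].
exists a2, (fun i => - a3 i), a0, (fun i => - a1 i).
rewrite /decomp -!quatN !mulrDr !(mulrA f) !f_quat -!mulrA (mulrA f e) fe mulNr.
rewrite -mulrA ff scale1r !mulr1 !mulrN !mulNr.
by rewrite -addrA addrC !addrA.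
Qed.

Lemma decomposable_quat b : decomposable (quat b).
Proof.
exists b, (fun=> 0), (fun=> 0), (fun=> 0).
by rewrite /decomp quat0 !mul0r !addr0.
Qed.

Lemma decomposable1 : decomposable 1.
Proof. by rewrite -[1]scale1r -(qelt_scalar C A x y) qxy_quat; exact: decomposable_quat. Qed.

Lemma decomposable_xl u : decomposable u -> decomposable (x * u).
Proof.
have -> : x = quat (of_seq [:: 0; 1; 0; 0]).
  by rewrite -qxy_quat /qelt !scale0r add0r !addr0 scale1r.
exact: decomposableMl.
Qed.

Lemma decomposable_yl u : decomposable u -> decomposable (y * u).
Proof.
have -> : y = quat (of_seq [:: 0; 0; 1; 0]).
  by rewrite -qxy_quat /qelt !scale0r !add0r addr0 scale1r.
exact: decomposableMl.
Qed.

Lemma decomposableZ c u : decomposable u -> decomposable (c *: u).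
Proof.
have -> : c *: u = quat (of_seq [:: c; 0; 0; 0]) * u.
  by rewrite -qxy_quat qelt_scalar -scalerAl mul1r.
exact: decomposableMl.
Qed.

(** * Conjugation by P_2 and then by P_4 *)

Lemma mulmx_scalarE n (M : 'M[A]_n) u i j : (M *m u%:M) i j = M i j * u.
Proof.
rewrite mxE (bigD1 j) //= big1 => [|k /negPf nkj]; rewrite mxE ?eqxx ?addr0 //.
by rewrite nkj mulr0.
Qed.

Definition P2mx : 'M[A]_2 :=
  \matrix_(i, j) (2%:R^-1 *:
    (if (i == 0) && (j == 0) then 1 - 'i *: x
     else if i == 0 then y + 'i *: (x * y)
     else if j == 0 then - y + 'i *: (x * y)
     else 1 + 'i *: x)).

(** Coordinates of the entries of 2 P_2, the form in which [qeltM] applies to them. *)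
Definition P2_coef (i j : 'I_2) : 'I_4 -> C :=
  of_seq (if (i == 0) && (j == 0) then [:: 1; - 'i; 0; 0]
          else if i == 0 then [:: 0; 0; 1; 'i]
          else if j == 0 then [:: 0; 0; -1; 'i]
          else [:: 1; 'i; 0; 0]).

Lemma P2mxE i j : P2mx i j = 2%:R^-1 *: quat (P2_coef i j).
Proof.
rewrite mxE quatE /P2_coef /qelt.
by case: (i == 0); case: (j == 0); rewrite /of_seq /= ?scale0r ?scale1r
  ?add0r ?addr0 ?scaleN1r ?scaleNr.
Qed.

Definition phi2mx b : 'M[A]_2 := map_mx (in_alg A) (phi2 b).

(** Under phi_2 the (i,j) entry of P_2 corresponds to the matrix unit E_ji. The (i,j) entry of the
    product is therefore the sum over k of E_ki b E_jk, which is the (i,j) entry of phi_2(b) times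
    1. The proof checks this in coordinates. *)
Lemma P2mx_sandwich b : P2mx *m (quat b)%:M *m P2mx = phi2mx b.
Proof.
have ii : 'i * 'i = -1 :> C by rewrite -expr2 sqrCi.
apply/matrixP=> i j; rewrite mxE !big_ord_recl big_ord0 !mulmx_scalarE !P2mxE !mxE.
rewrite /= -(qelt_scalar C A x y).
have [k ->|->] := unliftP ord0 i; have [l ->|->] := unliftP ord0 j;
  rewrite ?ord1 -!scalerAl -!scalerAr !quatE !qxyM !qeltZ addr0 qeltD /P2_coef /of_seq /=;
  congr qelt; by field: ii.
Qed.

(** The product ur lies in the algebra of e and f, so it moves left past b and the entries of P_2,
    leaving the sandwich of b alone. *)
Lemma scale_sandwich b q c0 c1 c2 c3 d0 d1 d2 d3
    (u := qef c0 c1 c2 c3) (r := qef d0 d1 d2 d3) :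
  (q *: P2mx) *m (quat b * u)%:M *m (r *: P2mx) = (q * u * r) *: phi2mx b.
Proof.
have urP2 i j : GRing.comm (u * r) (P2mx i j).
  rewrite P2mxE quatE qeltZ; apply: commr_sym.
  by apply: commrM; apply: commr_sym; apply: qef_comm_qxy.
have urb : GRing.comm (u * r) (quat b).
  by rewrite quatE; apply: commr_sym; apply: commrM; apply: commr_sym; apply: qef_comm_qxy.
rewrite -!scalemxAl -P2mx_sandwich -mulrA -scalerA; congr (q *: _).
apply/matrixP=> i j; rewrite [LHS]mxE [RHS]mxE [X in _ = _ * X]mxE mulr_sumr.
apply: eq_bigr => k _; rewrite !mulmx_scalarE [(r *: P2mx) k j]mxE.
by rewrite [RHS]mulrA (mulrA (u * r)) urP2 -(mulrA _ (u * r)) urb !mulrA.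
Qed.

(** Writing 1, e, f, ef in coordinates makes each summand an instance of [scale_sandwich]. *)
Lemma decompE a0 a1 a2 a3 :
  decomp a0 a1 a2 a3 = quat a0 * qef 1 0 0 0 + quat a1 * qef 0 1 0 0
    + quat a2 * qef 0 0 1 0 + quat a3 * qef 0 0 0 1.
Proof. by rewrite /qelt !scale0r !scale1r !(add0r, addr0) mulr1. Qed.

Lemma scale_sandwich_decomp q d0 d1 d2 d3 a0 a1 a2 a3 (r := qef d0 d1 d2 d3) :
  (q *: P2mx) *m (decomp a0 a1 a2 a3)%:M *m (r *: P2mx) =
  (q * qef 1 0 0 0 * r) *: phi2mx a0 + (q * qef 0 1 0 0 * r) *: phi2mx a1
  + (q * qef 0 0 1 0 * r) *: phi2mx a2 + (q * qef 0 0 0 1 * r) *: phi2mx a3.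
Proof. by rewrite decompE !(raddfD (@scalar_mx A 2)) !mulmxDr !mulmxDl !scale_sandwich. Qed.

Definition P4mx : 'M[A]_(2 + 2) :=
  map_mx ( *:%R 2%:R^-1)
    (block_mx ((1 + e) *: P2mx) ((f - e * f) *: P2mx)
              ((f + e * f) *: P2mx) ((1 - e) *: P2mx)).

Definition rhs4mx a0 a1 a2 a3 : 'M[A]_(2 + 2) :=
  map_mx (in_alg A)
    (block_mx (phi2 a0 + phi2 a1) (phi2 a2 + phi2 a3)
              (phi2 a2 - phi2 a3) (phi2 a0 - phi2 a1)).

Let h : C := 2%:R^-1.

(** With e as diag(1,-1) and f as the swap matrix, the coefficient of P_2 in block (i,j) corresponds
    to the matrix unit E_ji, the same pattern as in P_2 itself. *)
Lemma P4mxE : P4mx = block_mx (qef h h 0 0 *: P2mx) (qef 0 0 h (- h) *: P2mx)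
                        (qef 0 0 h h *: P2mx) (qef h (- h) 0 0 *: P2mx).
Proof.
have scaleP2 (q : A) : map_mx ( *:%R h) (q *: P2mx) = (h *: q) *: P2mx.
  by apply/matrixP=> i j; rewrite !mxE scalerAl.
rewrite /P4mx map_block_mx !scaleP2 /qelt !scale0r !(add0r, addr0) !scaleNr.
by rewrite !scalerDr !scalerN.
Qed.

Lemma P4mx_sandwich a0 a1 a2 a3 :
  P4mx *m (decomp a0 a1 a2 a3)%:M *m P4mx = rhs4mx a0 a1 a2 a3.
Proof.
(* A block of the product has two summands, one for each intermediate block index; their
   coefficients are to add up to scalars. *)
have addphi (s0 s1 s2 s3 t0 t1 t2 t3 : A) c0 c1 c2 c3 :
  s0 + t0 = c0%:A -> s1 + t1 = c1%:A -> s2 + t2 = c2%:A -> s3 + t3 = c3%:A ->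
  s0 *: phi2mx a0 + s1 *: phi2mx a1 + s2 *: phi2mx a2 + s3 *: phi2mx a3 +
  (t0 *: phi2mx a0 + t1 *: phi2mx a1 + t2 *: phi2mx a2 + t3 *: phi2mx a3) =
  map_mx (in_alg A) (c0 *: phi2 a0 + c1 *: phi2 a1 + c2 *: phi2 a2 + c3 *: phi2 a3).
  move=> e0 e1 e2 e3; rewrite !map_mxD !map_mxZ /= -e0 -e1 -e2 -e3 !scalerDl.
  by do 3 (rewrite addrACA; congr (_ + _)).
rewrite P4mxE (scalar_mx_block 2 2) !mulmx_block !mulmx0 !addr0 !add0r.
rewrite !scale_sandwich_decomp /rhs4mx map_block_mx.
congr block_mx.
(* In block (i,j) the four constants are the (i,j) entries of the matrices of 1, e, f, ef, because
   the sum over k of E_ki M E_jk is M_ij times 1. *)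
- rewrite (addphi _ _ _ _ _ _ _ _ 1 1 0 0);
    try by rewrite -(qelt_scalar C A e f) !qefM qeltD; congr qelt; rewrite /h; field.
  by rewrite !scale0r !scale1r !addr0.
- rewrite (addphi _ _ _ _ _ _ _ _ 0 0 1 1);
    try by rewrite -(qelt_scalar C A e f) !qefM qeltD; congr qelt; rewrite /h; field.
  by rewrite !scale0r !scale1r !add0r.
- rewrite (addphi _ _ _ _ _ _ _ _ 0 0 1 (-1));
    try by rewrite -(qelt_scalar C A e f) !qefM qeltD; congr qelt; rewrite /h; field.
  by rewrite !scale0r !scale1r !add0r scaleN1r.
- rewrite (addphi _ _ _ _ _ _ _ _ 1 (-1) 0 0);
    try by rewrite -(qelt_scalar C A e f) !qefM qeltD; congr qelt; rewrite /h; field.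
  by rewrite !scale0r !scale1r !addr0 scaleN1r.
Qed.

Lemma P4mx_sqr : P4mx *m P4mx = 1%:M.
Proof.
have := P4mx_sandwich (of_seq [:: 1; 0; 0; 0]) (fun=> 0) (fun=> 0) (fun=> 0).
rewrite /decomp -qxy_quat qelt_scalar quat0 !mul0r !addr0 scale1r mulmx1 => ->.
have phi0 : phi2 (fun=> 0) = 0 :> 'M[C]_2.
  by apply/matrixP=> i j; rewrite !mxE !mul0r !(addr0, oppr0) !if_same.
have phi1 : phi2 (of_seq [:: 1; 0; 0; 0]) = 1%:M :> 'M[C]_2.
  apply/matrixP=> i j; rewrite !mxE /of_seq /= !mul0r !(addr0, oppr0).
  by have [k ->|->] := unliftP ord0 i; have [l ->|->] := unliftP ord0 j; rewrite ?ord1.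
by rewrite /rhs4mx phi0 phi1 !(addr0, subr0) -(scalar_mx_block 2 2 1) map_scalar_mx /= scale1r.
Qed.

End TensorDecomposition.

(** * The relations between e_1, e_2, e_123 and e_124 in C_4 *)

Section Theorem13.
Variable C : numClosedFieldType.

Local Notation R := (clifford C).
Local Notation "''e1'" := (e1 C : R).
Local Notation "''e2'" := (e2 C : R).
Local Notation "''E'" := (e123 C : R).
Local Notation "''F'" := (e124 C : R).

Lemma e11 : 'e1 * 'e1 = (-1)%:A. Proof. by rewrite scaleN1r; exact: gen_sqr. Qed.
Lemma e22 : 'e2 * 'e2 = (-1)%:A. Proof. by rewrite scaleN1r; exact: gen_sqr. Qed.
Lemma e21 : 'e2 * 'e1 = - ('e1 * 'e2). Proof. exact: gen_anticomm. Qed.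

Lemma e12_sqr : ('e1 * 'e2) * ('e1 * 'e2) = -1.
Proof.
rewrite mulrA -(mulrA 'e1) e21 mulrN mulrA e11 mulNr -mulrA e22.
by rewrite scaleN1r mulN1r opprK.
Qed.

(** * Products of e_12 with e_3 or e_4, the generators of index 2 and 3 *)

Section GeneratorsAboveE2.
Variable k : 'I_4.
Hypothesis k_ge2 : (1 < k)%N.
Let x : R := gen C k.
Let w : R := 'e1 * 'e2.

Lemma gen_e1 : x * 'e1 = - ('e1 * x).
Proof. by apply: gen_anticomm; rewrite -val_eqE /=; case: val k_ge2. Qed.
Lemma gen_e2 : x * 'e2 = - ('e2 * x).
Proof. by apply: gen_anticomm; rewrite -val_eqE /=; case: val k_ge2 => [|[]]. Qed.

Lemma e12_comm : GRing.comm w x.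
Proof.
by rewrite /GRing.comm /w mulrA gen_e1 mulNr -!mulrA gen_e2 mulrN opprK.
Qed.

(** Here w commutes with x and w^2 = -1. Taking x and y among e_3, e_4 gives the squares of e_123
    and e_124 and both of their products. *)
Lemma e12genM (y : R) : (w * x) * (w * y) = - (x * y).
Proof. by rewrite mulrA -(mulrA w x w) -e12_comm (mulrA w w) e12_sqr mulN1r mulNr. Qed.

(** Both e_12 and x anticommute with e_1, so the two signs cancel. *)
Lemma e12gen_e1 : GRing.comm (w * x) 'e1.
Proof.
rewrite /GRing.comm -mulrA gen_e1 mulrN (mulrA w) /w -(mulrA 'e1 'e2 'e1) e21.
by rewrite mulrN mulNr opprK !mulrA.
Qed.

Lemma e12gen_e2 : GRing.comm (w * x) 'e2.
Proof.
rewrite /GRing.comm -mulrA gen_e2 mulrN (mulrA w) /w !mulrA e21.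
by rewrite !mulNr.
Qed.

End GeneratorsAboveE2.

Lemma e123_sqr : 'E * 'E = 1%:A.
Proof. by rewrite scale1r [LHS]e12genM // gen_sqr opprK. Qed.

Lemma e124_sqr : 'F * 'F = 1%:A.
Proof. by rewrite scale1r [LHS]e12genM // gen_sqr opprK. Qed.

Lemma e43E : (e43 C : R) = 'E * 'F.
Proof. by rewrite [RHS]e12genM //; apply: gen_anticomm. Qed.

Lemma e124M123 : 'F * 'E = - ('E * 'F).
Proof. by rewrite -e43E [LHS]e12genM. Qed.

Lemma E_e1 : GRing.comm 'E 'e1. Proof. exact: e12gen_e1. Qed.
Lemma E_e2 : GRing.comm 'E 'e2. Proof. exact: e12gen_e2. Qed.
Lemma F_e1 : GRing.comm 'F 'e1. Proof. exact: e12gen_e1. Qed.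
Lemma F_e2 : GRing.comm 'F 'e2. Proof. exact: e12gen_e2. Qed.

Lemma c2eltE b : c2elt b = quat C R 'e1 'e2 b.
Proof. by rewrite quatE /c2elt clCE. Qed.

Lemma decomp_c2elt a0 a1 a2 a3 :
  c2elt a0 + clmul (c2elt a1) (e123 C) + clmul (c2elt a2) (e124 C)
    + clmul (c2elt a3) (e43 C) = decomp C R 'e1 'e2 'E 'F a0 a1 a2 a3.
Proof. by rewrite /decomp -e43E -!c2eltE. Qed.

Lemma decomp_c2eltC a0 a1 a2 a3 :
  c2elt a0 + clmul (e123 C) (c2elt a1) + clmul (e124 C) (c2elt a2)
    + clmul (e43 C) (c2elt a3) = decomp C R 'e1 'e2 'E 'F a0 a1 a2 a3.
Proof.
rewrite (decompC C R 'e1 'e2 'E 'F E_e1 E_e2 F_e1 F_e2).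
by rewrite -e43E -!c2eltE.
Qed.

(** * Every element of C_4 has a decomposition over C_2 *)

Local Notation dec := (decomposable C R 'e1 'e2 'E 'F).
Local Notation decZ := (decomposableZ C R 'e1 'e2 'E 'F e11 e22 e21).
Local Notation dec_el := (decomposable_el C R 'e1 'e2 'E 'F e123_sqr E_e1 E_e2).
Local Notation dec_fl := (decomposable_fl C R 'e1 'e2 'E 'F e124_sqr e124M123 F_e1 F_e2).
Local Notation dec_xl := (decomposable_xl C R 'e1 'e2 'E 'F e11 e22 e21).
Local Notation dec_yl := (decomposable_yl C R 'e1 'e2 'E 'F e11 e22 e21).

Lemma decomposable_gen k (x : R) : dec x -> dec ((gen C k : R) * x).
Proof.
(* Since e_12^2 = -1, the generators e_3 and e_4 are recovered as -e_12 e_123 and -e_12 e_124. *)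
have gen3 l : (gen C l : R) * x =
    -1 *: ('e1 * ('e2 * (('e1 * 'e2 * (gen C l : R)) * x))).
  by rewrite (mulrA 'e1) -(mulrA ('e1 * 'e2)) mulrA e12_sqr scaleN1r mulN1r opprK.
move=> dx; case: k => -[|[|[|[|//]]]] lt_k4; rewrite (bool_irrelevance lt_k4 isT).
- exact: dec_xl.
- exact: dec_yl.
- rewrite gen3; exact/decZ/dec_xl/dec_yl/dec_el.
- rewrite gen3; exact/decZ/dec_xl/dec_yl/dec_fl.
Qed.

Lemma decomposable_blade (A : {set 'I_4}) : dec (blade C A).
Proof.
have [n] := ubnP #|A|; elim: n A => // n IHn A leAn.
have [->|[k Ak]] := set_0Vmem A; first exact: decomposable1.
have <- : symdiff [set k] (A :\ k) = A.
  apply/setP=> i; rewrite in_symdiff !inE.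
  by case: eqP => [->|_]; rewrite ?Ak // addFb.
(* The product of e_k and the smaller blade is the blade of A up to a sign; writing 1 as the square
   of that sign solves for the blade of A. *)
rewrite -[blade _ _](@scale1r C R) -(clsign_sqr C [set k] (A :\ k)) -scalerA -blade_mul.
apply/decZ/decomposable_gen/IHn.
by move: leAn; rewrite (cardsD1 k) Ak.
Qed.

Lemma decomposableT (a : R) : dec a.
Proof.
have -> : a = \sum_(A : {set 'I_4}) (a : Cl C) A *: (blade C A : R).
  apply/ffunP=> D; rewrite sum_ffunE (bigD1 D) //= big1 => [|A nA].
    by rewrite ffunE ffunE eqxx mulr1 addr0.
  by rewrite ffunE ffunE eq_sym (negPf nA) mulr0.
elim/big_ind: _ => [|x y|A _].
- rewrite -[0](scale0r (blade C set0 : R)).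
  exact/decZ/decomposable_blade.
- exact: decomposableD.
- exact/decZ/decomposable_blade.
Qed.

(** * Translation of the concrete operations into ring and matrix operations *)

Lemma clmxmulE m n p (M : 'M[R]_(m, n)) (N : 'M[R]_(n, p)) :
  clmxmul M N = M *m N.
Proof. by apply/matrixP=> i j; rewrite !mxE. Qed.

Lemma clscalmxE n (a : R) : clscalmx n a = a%:M.
Proof. by apply/matrixP=> i j; rewrite !mxE; case: eqP. Qed.

Lemma map_clC m n (M : 'M[C]_(m, n)) : map_mx (@clC C) M = map_mx (in_alg R) M.
Proof. by apply/matrixP=> i j; rewrite !mxE clCE. Qed.

Lemma P2E : P2 C = P2mx C R 'e1 'e2.
Proof. by []. Qed.

Lemma P4E : P4 C = P4mx C R 'e1 'e2 'E 'F.
Proof.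
rewrite /P4 /P4mx -e43E -P2E.
have clscaleE m n (c : R) (M : 'M[R]_(m, n)) : clscale c M = c *: M.
  by apply/matrixP=> i j; rewrite !mxE.
by rewrite !clscaleE.
Qed.

End Theorem13.

Theorem theorem13 (C : numClosedFieldType) :
  [/\ [/\ clmul (e123 C) (e123 C) = cl1 C,
          clmul (e124 C) (e124 C) = cl1 C,
          e43 C = clmul (e123 C) (e124 C)
        & e43 C = - clmul (e124 C) (e123 C)],
      (forall a : Cl C, exists a0 a1 a2 a3 : 'I_4 -> C,
          a = c2elt a0 + clmul (c2elt a1) (e123 C) + clmul (c2elt a2) (e124 C)
              + clmul (c2elt a3) (e43 C)),
      (forall a0 a1 a2 a3 : 'I_4 -> C,
          c2elt a0 + clmul (c2elt a1) (e123 C) + clmul (c2elt a2) (e124 C)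
              + clmul (c2elt a3) (e43 C)
          = c2elt a0 + clmul (e123 C) (c2elt a1) + clmul (e124 C) (c2elt a2)
              + clmul (e43 C) (c2elt a3)),
      clmxmul (P4 C) (P4 C) = clscalmx 4 (cl1 C)
    & forall (a : Cl C) (a0 a1 a2 a3 : 'I_4 -> C),
        a = c2elt a0 + clmul (c2elt a1) (e123 C) + clmul (c2elt a2) (e124 C)
              + clmul (c2elt a3) (e43 C) ->
        clmxmul (clmxmul (P4 C) (clscalmx 4 a)) (P4 C)
          = map_mx (@clC C) (rhs4 a0 a1 a2 a3)
        /\ clmxmul (P4 C) (clmxmul (clscalmx 4 a) (P4 C))
          = map_mx (@clC C) (rhs4 a0 a1 a2 a3)].
Proof.
have sandwich a0 a1 a2 a3 :
    (P4 C : 'M[clifford C]_4)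
      *m (decomp C (clifford C) (e1 C) (e2 C) (e123 C) (e124 C) a0 a1 a2 a3)%:M
      *m (P4 C : 'M[clifford C]_4) = map_mx (@clC C) (rhs4 a0 a1 a2 a3).
  rewrite map_clC P4E.
  exact: (P4mx_sandwich _ _ _ _ _ _ (e11 C) (e22 C) (e21 C) (e123_sqr C)
           (e124_sqr C) (e124M123 C) (E_e1 C) (E_e2 C) (F_e1 C) (F_e2 C)).
split.
- split.
  + by rewrite -[RHS](scale1r (1 : clifford C)); exact: e123_sqr.
  + by rewrite -[RHS](scale1r (1 : clifford C)); exact: e124_sqr.
  + exact: e43E.
  + by rewrite [LHS]e43E; apply/esym/eqP; rewrite eqr_oppLR; apply/eqP; exact: e124M123.
- move=> a; have [a0 [a1 [a2 [a3 ->]]]] := decomposableT C a.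
  by exists a0, a1, a2, a3; rewrite decomp_c2elt.
- by move=> a0 a1 a2 a3; rewrite decomp_c2elt decomp_c2eltC.
- rewrite clscalmxE clmxmulE P4E.
  exact: (P4mx_sqr _ _ _ _ _ _ (e11 C) (e22 C) (e21 C) (e123_sqr C) (e124_sqr C)
           (e124M123 C) (E_e1 C) (E_e2 C) (F_e1 C) (F_e2 C)).
- move=> a a0 a1 a2 a3; rewrite decomp_c2elt => ->.
  (* Since P_4 is its own inverse, both bracketings express the conjugation, and associativity
     identifies them. *)
  rewrite !clmxmulE !clscalmxE mulmxA.
  by split; exact: sandwich.
Qed.
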